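(* Let $\{y^k\}$ and $\{u^k\}$ be sequences generated by the SCO algorithm: $y^0\in F$, $u^0=y^0$, and for each $k\ge0$, $y^{k+1}$ is an optimal solution of the convex problem $$\min\ f_u(y)\quad\text{s.t.}\quad g_u(y)\le0,\ h_u(y)\le0,\ y\in D$$ with $u=u^k$, and $u^{k+1}=y^{k+1}$. Then: (1) $\{y^k\}\subseteq F$; (2) $f(y^k)-f(y^{k+1})\ge (u^{k+1}-u^k)^TA^-(u^{k+1}-u^k)$ for every $k$.
   Context: Data: $m\ge1$; $x_0\in\mathbb{R}^m$ with positive components; diagonal $m\times m$ matrices $\Lambda,\Gamma$ with positive diagonal entries; $p_0\in\mathbb{R}^m$; $l_0,e_0\in\mathbb{R}$ (with $e_0=p_0^Tx_0-l_0$); $\rho_1,\rho_2>0$; $\pi\in(0,1)$; $\delta\ge0$. Write $y=(y_1^T,y_2^T)^T\in\mathbb{R}^{2m}$ with $y_1,y_2\in\mathbb{R}^m$, and (inequalities componentwise) $$D=\{(y_1,y_2): -x_0\le y_1\le 0,\ -x_0\le y_2\le0,\ y_1+y_2\ge -x_0\}.$$ Let $f(y)=y^TQ_0y+q_0^Ty+c_0$, $g(y)=y^TQ_1y+q_1^Ty+c_1$, $h(y)=y^TQ_2y+q_2^Ty+c_2$, where $$Q_0=\begin{bmatrix}\Lambda-\frac{\Gamma}{2}&-\frac{\pi}{2}\Gamma\\-\frac{\pi}{2}\Gamma&\pi(\Lambda-\frac{\Gamma}{2})\end{bmatrix},\ q_0=-\begin{bmatrix}\Gamma x_0\\ \pi\Gamma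 x_0\end{bmatrix},\ c_0=\pi\delta-e_0,$$ $$Q_1=\begin{bmatrix}\rho_1(\Lambda-\frac{\Gamma}{2})+\Lambda+\frac{\Gamma}{2}&O\\O&O\end{bmatrix},\ q_1=\begin{bmatrix}p_0-\rho_1\Gamma x_0\\0\end{bmatrix},\ c_1=l_0-\rho_1e_0,$$ $$Q_2=\begin{bmatrix}\Lambda+\frac{\Gamma}{2}+\rho_2(\Lambda-\frac{\Gamma}{2})&\frac{1-\rho_2}{2}\Gamma\\ \frac{1-\rho_2}{2}\Gamma&\Lambda+\frac{\Gamma}{2}+\rho_2(\Lambda-\frac{\Gamma}{2})\end{bmatrix},\ q_2=\begin{bmatrix}p_0-\rho_2\Gamma x_0\\ p_0-\rho_2\Gamma x_0\end{bmatrix},\ c_2=l_0-\rho_2e_0+(\rho_2+1)\delta.$$ Let $F=\{y\in D: g(y)\le0,\ h(y)\le0\}$. For a real symmetric matrix $Q$ with eigenvalues $v_i$ and corresponding orthonormal eigenvectors $w_i$, write $Q=Q^+-Q^-$ with $Q^+=\sum_{v_i\ge0}v_iw_iw_i^T$ and $Q^-=\sum_{v_i<0}|v_i|w_iw_i^T$. Set $A^\pm=Q_0^\pm$, $B^\pm=Q_1^\pm$, $C^\pm=Q_2^\pm$. For $u\in D$ define $$f_u(y)=y^TA^+y-2u^TA^-y+q_0^Ty+u^TA^-u+c_0,$$ $$g_u(y)=y^TB^+y-2u^TB^-y+q_1^Ty+u^TB^-u+c_1,\qquad h_u(y)=y^TC^+y-2u^TC^-y+q_2^Ty+u^TC^-u+c_2.$$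 (The algorithm stops when $\|u^{k+1}-u^k\|$ falls below a tolerance; the statement concerns the iterates generated.) Standing assumption of the paper: there is a point satisfying all constraints defining $F$ strictly, and $\rho_1e_0-l_0<0$. *)

(* Defs.v *)
From mathcomp Require Import all_boot all_order all_algebra.
From mathcomp Require Import reals classical_sets.

Set Implicit Arguments.
Unset Strict Implicit.
Unset Printing Implicit Defensive.

Import Order.TTheory GRing.Theory Num.Theory.
Local Open Scope classical_set_scope.
Local Open Scope ring_scope.

Section QuadraticFunctions.
Context {R : realType} {n : nat}.
Implicit Types (Q : 'M[R]_n) (q u v y : 'cV[R]_n) (c : R).

Definition dotv u v : R := (u^T *m v) 0 0.

Definition bilin Q u v : R := (u^T *m Q *m v) 0 0.

Definition quad Q q c y : R := bilin Q y y + dotv q y + c.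

(* With Q = Qp - Qm, the concave part - y^T Qm y of [quad Q q c] is replaced by
   its tangent at u. *)
Definition linearized Qp Qm q c u y : R :=
  bilin Qp y y - 2 * bilin Qm u y + dotv q y + bilin Qm u u + c.

Definition orthonormal_eigensystem Q (v : 'I_n -> R) (w : 'I_n -> 'cV[R]_n) :=
  (forall i j, dotv (w i) (w j) = (i == j)%:R) /\
  (forall i, Q *m w i = v i *: w i).

(* Qp and Qm are Q^+ and Q^-. Stated as a relation, because the eigenvectors
   are a choice; the two matrices do not depend on it. *)
Definition spectral_split Q Qp Qm :=
  exists (v : 'I_n -> R) (w : 'I_n -> 'cV[R]_n),
  [/\ orthonormal_eigensystem Q v w,
      Qp = \sum_(i | 0 <= v i) v i *: (w i *m (w i)^T) &
      Qm = \sum_(i | v i < 0) `|v i| *: (w i *m (w i)^T)].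

Definition is_minimizer (phi : 'cV[R]_n -> R) (S : set 'cV[R]_n) y :=
  S y /\ forall z, S z -> phi y <= phi z.

End QuadraticFunctions.

Section ProblemData.
Context {R : realType} {m : nat}.
Implicit Types (x p : 'cV[R]_m) (Lam Gam : 'M[R]_m).

(* A vector y of R^(2m) has y_1 = usubmx y and y_2 = dsubmx y. *)
Definition D x0 : set 'cV[R]_(m + m) := [set y | forall i : 'I_m,
  [/\ - x0 i 0 <= usubmx y i 0 <= 0,
      - x0 i 0 <= dsubmx y i 0 <= 0 &
      - x0 i 0 <= usubmx y i 0 + dsubmx y i 0]].

Definition D_strict x0 : set 'cV[R]_(m + m) := [set y | forall i : 'I_m,
  [/\ - x0 i 0 < usubmx y i 0 < 0,
      - x0 i 0 < dsubmx y i 0 < 0 &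
      - x0 i 0 < usubmx y i 0 + dsubmx y i 0]].

Definition Q0 Lam Gam (pi : R) : 'M[R]_(m + m) :=
  block_mx (Lam - 2^-1 *: Gam)   (- ((pi / 2) *: Gam))
           (- ((pi / 2) *: Gam)) (pi *: (Lam - 2^-1 *: Gam)).

Definition q0 Gam x0 (pi : R) : 'cV[R]_(m + m) :=
  - col_mx (Gam *m x0) (pi *: (Gam *m x0)).

Definition c0 (pi delta e0 : R) : R := pi * delta - e0.

Definition Q1 Lam Gam (rho1 : R) : 'M[R]_(m + m) :=
  block_mx (rho1 *: (Lam - 2^-1 *: Gam) + Lam + 2^-1 *: Gam) 0
           0                                                 0.

Definition q1 Gam x0 p0 (rho1 : R) : 'cV[R]_(m + m) :=
  col_mx (p0 - rho1 *: (Gam *m x0)) 0.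

Definition c1 (l0 e0 rho1 : R) : R := l0 - rho1 * e0.

Definition Q2 Lam Gam (rho2 : R) : 'M[R]_(m + m) :=
  block_mx (Lam + 2^-1 *: Gam + rho2 *: (Lam - 2^-1 *: Gam))
           (((1 - rho2) / 2) *: Gam)
           (((1 - rho2) / 2) *: Gam)
           (Lam + 2^-1 *: Gam + rho2 *: (Lam - 2^-1 *: Gam)).

Definition q2 Gam x0 p0 (rho2 : R) : 'cV[R]_(m + m) :=
  col_mx (p0 - rho2 *: (Gam *m x0)) (p0 - rho2 *: (Gam *m x0)).

Definition c2 (l0 e0 rho2 delta : R) : R :=
  l0 - rho2 * e0 + (rho2 + 1) * delta.

(* The feasible set of the original problem is [feasible x0 g h], that of the
   subproblem at u is [feasible x0 (g_ u) (h_ u)]. *)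
Definition feasible x0 (g h : 'cV[R]_(m + m) -> R) : set 'cV[R]_(m + m) :=
  [set y | [/\ D x0 y, g y <= 0 & h y <= 0]].

(* f_ u, g_ u and h_ u are the objective and the constraints of the convex
   subproblem at u. The sequences are infinite: the stopping test is left out. *)
Definition SCO_sequences x0 (F : set 'cV[R]_(m + m))
    (f_ g_ h_ : 'cV[R]_(m + m) -> 'cV[R]_(m + m) -> R)
    (y u : nat -> 'cV[R]_(m + m)) :=
  [/\ F (y 0%N), u 0%N = y 0%N &
      forall k, is_minimizer (f_ (u k)) (feasible x0 (g_ (u k)) (h_ (u k)))
                  (y k.+1)
                /\ u k.+1 = y k.+1].

End ProblemData.

(* Main.v *)
(* A quadratic function is majorized by its linearization at u, with gap the
   positive semidefinite form of Q^- at y - u. So the constraints of the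
   subproblem imply the original ones; and since y^k is itself feasible for the
   subproblem at u^k = y^k, optimality of y^(k+1) turns the gap of the objective
   into the claimed decrease. *)
Require Import Defs.
From mathcomp Require Import all_boot all_order all_algebra.
From mathcomp Require Import reals classical_sets.
From mathcomp Require Import ring.

Set Implicit Arguments.
Unset Strict Implicit.
Unset Printing Implicit Defensive.

Import Order.TTheory GRing.Theory Num.Theory.
Local Open Scope classical_set_scope.
Local Open Scope ring_scope.

Section QuadraticFunctions.
Context {R : realType} {n : nat}.
Implicit Types (Q Qp Qm : 'M[R]_n) (q u v y d : 'cV[R]_n) (c : R).

(** With the [w i] as columns of [W], orthonormality says [W^T *m W = 1%:M]. A left inverse of a
    square matrix is also a right inverse, and [W *m W^T] is the sum of the projectors. *)
Lemma sum_orthonormal_proj (w : 'I_n -> 'cV[R]_n) :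
  (forall i j, dotv (w i) (w j) = (i == j)%:R) ->
  \sum_i w i *m (w i)^T = 1%:M.
Proof.
move=> w_on; pose W := \matrix_(i, j) w j i 0.
have /mulmx1C <- : W^T *m W = 1%:M.
  apply/matrixP => i j; rewrite !mxE -w_on /dotv mxE.
  by apply: eq_bigr => k _; rewrite !mxE.
apply/matrixP => i j; rewrite summxE !mxE.
by apply: eq_bigr => k _; rewrite !mxE big_ord1 !mxE.
Qed.

(** Multiplying [Q] by the resolution of the identity gives the terms [v i *: (w i *m (w i)^T)].
    They are grouped by the sign of [v i], with [v i = - |v i|] on the negative part. *)
Lemma spectral_splitE Q Qp Qm : spectral_split Q Qp Qm -> Q = Qp - Qm.
Proof.
move=> [v [w [[w_on Qw] -> ->]]].
rewrite -[LHS]mulmx1 -(sum_orthonormal_proj w_on) mulmx_sumr.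
rewrite (bigID (fun i => 0 <= v i)) /= -sumrN; congr (_ + _).
  by apply: eq_bigr => i _; rewrite mulmxA Qw -scalemxAl.
apply: eq_big => i; rewrite -ltNge // => vi_lt0.
by rewrite mulmxA Qw -scalemxAl ltr0_norm // scaleNr opprK.
Qed.

Lemma spectral_split_neg_sym Q Qp Qm : spectral_split Q Qp Qm -> Qm^T = Qm.
Proof.
move=> [v [w [_ _ ->]]]; rewrite linear_sum; apply: eq_bigr => i _.
by rewrite linearZ /= trmx_mul trmxK.
Qed.

(** Each eigenvector contributes [|v i|] times the square of the scalar [d^T *m w i]. *)
Lemma spectral_split_neg_ge0 Q Qp Qm d :
  spectral_split Q Qp Qm -> 0 <= bilin Qm d d.
Proof.
move=> [v [w [_ _ ->]]]; rewrite /bilin mulmx_sumr mulmx_suml summxE.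
apply: sumr_ge0 => i _; rewrite -scalemxAr -scalemxAl mxE mulr_ge0 //.
have -> : d^T *m (w i *m (w i)^T) *m d = (d^T *m w i) *m (d^T *m w i)^T.
  by rewrite trmx_mul trmxK !mulmxA.
by rewrite mxE big_ord1 [X in _ * X]mxE -expr2 sqr_ge0.
Qed.

Lemma bilinC Q u v : Q^T = Q -> bilin Q u v = bilin Q v u.
Proof.
move=> Qsym; have -> : bilin Q u v = (v^T *m Q *m u)^T 0 0.
  by rewrite !trmx_mul trmxK Qsym mulmxA.
by rewrite mxE.
Qed.

Lemma bilin_subsub Q u v : Q^T = Q ->
  bilin Q (u - v) (u - v) = bilin Q u u - 2 * bilin Q v u + bilin Q v v.
Proof.
move=> Qsym.
have -> : bilin Q (u - v) (u - v)
    = bilin Q u u - bilin Q v u - (bilin Q u v - bilin Q v v).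
  by rewrite /bilin [(u - v)^T]linearB /= !mulmxBl !mulmxBr !mxE; ring.
by rewrite (bilinC u v Qsym); ring.
Qed.

(** Adding and subtracting [bilin Qm y y] completes the terms in [Qm] to a square; the symmetry of
    [Qm] merges the two cross terms. *)
Lemma linearizedE Q Qp Qm q c u y : spectral_split Q Qp Qm ->
  linearized Qp Qm q c u y = quad Q q c y + bilin Qm (y - u) (y - u).
Proof.
move=> split_Q; rewrite (bilin_subsub _ _ (spectral_split_neg_sym split_Q)).
rewrite /linearized /quad {1}(spectral_splitE split_Q).
have -> : bilin (Qp - Qm) y y = bilin Qp y y - bilin Qm y y.
  by rewrite /bilin mulmxBr mulmxBl !mxE.
ring.
Qed.

Lemma linearized_diag Q Qp Qm q c u : spectral_split Q Qp Qm ->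
  linearized Qp Qm q c u u = quad Q q c u.
Proof.
move=> /linearizedE ->.
by rewrite subrr /bilin mulmx0 mxE addr0.
Qed.

Lemma quad_le_linearized Q Qp Qm q c u y : spectral_split Q Qp Qm ->
  quad Q q c y <= linearized Qp Qm q c u y.
Proof.
by move=> split_Q; rewrite (linearizedE _ _ _ _ split_Q) lerDl
  (spectral_split_neg_ge0 _ split_Q).
Qed.

End QuadraticFunctions.

Theorem proposition3p2 (R : realType) (m : nat) (x0 p0 : 'cV[R]_m)
    (Lam Gam : 'M[R]_m) (l0 e0 rho1 rho2 pi delta : R)
    (Ap Am Bp Bm Cp Cm : 'M[R]_(m + m))
    (y u : nat -> 'cV[R]_(m + m)) :
  let f := quad (Q0 Lam Gam pi) (q0 Gam x0 pi) (c0 pi delta e0) in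
  let g := quad (Q1 Lam Gam rho1) (q1 Gam x0 p0 rho1) (c1 l0 e0 rho1) in
  let h := quad (Q2 Lam Gam rho2) (q2 Gam x0 p0 rho2)
             (c2 l0 e0 rho2 delta) in
  let F := feasible x0 g h in
  let f_ := linearized Ap Am (q0 Gam x0 pi) (c0 pi delta e0) in
  let g_ := linearized Bp Bm (q1 Gam x0 p0 rho1) (c1 l0 e0 rho1) in
  let h_ := linearized Cp Cm (q2 Gam x0 p0 rho2) (c2 l0 e0 rho2 delta) in
  (1 <= m)%N ->
  (forall i, 0 < x0 i 0) ->
  is_diag_mx Lam -> (forall i, 0 < Lam i i) ->
  is_diag_mx Gam -> (forall i, 0 < Gam i i) ->
  e0 = dotv p0 x0 - l0 ->
  0 < rho1 -> 0 < rho2 -> 0 < pi < 1 -> 0 <= delta ->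
  (exists z, [/\ D_strict x0 z, g z < 0 & h z < 0]) ->
  rho1 * e0 - l0 < 0 ->
  spectral_split (Q0 Lam Gam pi) Ap Am ->
  spectral_split (Q1 Lam Gam rho1) Bp Bm ->
  spectral_split (Q2 Lam Gam rho2) Cp Cm ->
  SCO_sequences x0 F f_ g_ h_ y u ->
  (forall k, F (y k)) /\
  (forall k, f (y k) - f (y k.+1) >=
             bilin Am (u k.+1 - u k) (u k.+1 - u k)).
Proof.
move=> f g h F f_ g_ h_ _ _ _ _ _ _ _ _ _ _ _ _ _ sf sg sh [F0 u0 step].
have uE k : u k = y k by case: k => // k; case: (step k).
(* Majorization holds at every [u k], so feasibility for the subproblem suffices, without induction
   on [k]. *)
have FS k : F (y k.+1).
  have [[[Dy gy hy] _] _] := step k.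
  by split=> //; [apply: le_trans gy | apply: le_trans hy];
    apply: quad_le_linearized.
have Fy k : F (y k) by case: k.
split=> // k; have [[_ min_y] _] := step k.
(* The linearizations are exact at their base point [u k = y k], where the subproblem constraints
   reduce to those of [F]. *)
have feas_yk : feasible x0 (g_ (u k)) (h_ (u k)) (y k).
  by have [Dy gy hy] := Fy k; rewrite uE; split=> //;
    rewrite /g_ /h_ (linearized_diag _ _ _ sg, linearized_diag _ _ _ sh).
(* The minimal value is [f (y k.+1)] plus the gap, and the competitor [y k] has value exactly
   [f (y k)]. *)
have := min_y _ feas_yk; rewrite !uE /f_ (linearized_diag _ _ _ sf).
by rewrite (linearizedE _ _ _ _ sf) -/f addrC -lerBrDr.
Qed.
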